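(* Let $B$ be a non-zero binomial domain, let $A$ be a non-zero $\mathbf{Z}$-torsionfree $\mathbf{Q}$-algebra, and let $N\ge2$. Each of the following filtered rings, equipped with the $x$-adic (or $\varepsilon$-adic) filtration, admits uncountably many mutually non-isomorphic filtered $\lambda$-ring structures: (a) the ring of dual numbers $B[\varepsilon]$, $\varepsilon^2=0$; (b) the polynomial ring $A[x]$, and the truncated polynomial ring $A[x]/x^N$; (c) the power series ring $A[[x]]$.
   Context: All rings are commutative with unit. A binomial domain is a $\mathbf{Z}$-torsionfree ring $B$ such that $\binom{b}{n}=\frac{b(b-1)\cdots(b-n+1)}{n!}\in B\otimes\mathbf{Q}$ lies in $B$ for all $b\in B$ and all positive integers $n$. A filtered ring is a ring $R$ with a decreasing sequence of ideals $R=I^0\supset I^1\supset\cdots$ with $I^nI^m\subseteq I^{n+m}$. A filtered ring homomorphism is a ring map preserving the filtrations. The $\varepsilon$-adic filtration on $B[\varepsilon]$ is $I^0=B[\varepsilon]$, $I^1=(\varepsilon)$, $I^n=0$ for $n\ge2$; the $x$-adic filtration is given by $I^n=(x^n)$. A filtered $\lambda$-ring is a filtered ring $R$ which is also a $\lambda$-ring (in the sense of Grothendieck, originally called special $\lambda$-ring, with operations $\lambda^i$) such that every filtration ideal is closed under $\lambda^i$ for all $i>0$. A filtered $\lambda$-ring map is a filtered ring homomorphism commuting with all $\lambda^i$; two filtered $\lambda$-ring structures on $R$ are isomorphic if there is an isomorphism of filtered $\lambda$-rings between them. *)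

(* Defs.v *)
From HB Require Import structures.
From mathcomp Require Import all_boot all_order all_algebra.
From mathcomp Require Import perm qpoly.
From mathcomp Require Import boolp classical_sets cardinality.
From mathcomp Require Import mpoly.

Set Implicit Arguments.
Unset Strict Implicit.
Unset Printing Implicit Defensive.
Import GRing.Theory.
Local Open Scope ring_scope.

Definition Ztorsionfree (R : nzRingType) : Prop :=
  forall (n : nat) (x : R), (0 < n)%N -> x *+ n = 0 -> x = 0.

(* When [B] is torsion-free it embeds in its rationalization, where the
   fraction b(b-1)...(b-n+1)/n! is the element [c] of [B] iff n! c equals the
   numerator. *)
Definition binomial_domain (B : comNzRingType) : Prop :=
  Ztorsionfree B /\
  forall (b : B) (n : nat), (0 < n)%N ->
    exists c : B, c *+ n`! = \prod_(i < n) (b - i%:R).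

Section Filtrations.
Local Open Scope classical_set_scope.

Definition ideal (R : comNzRingType) (I : set R) : Prop :=
  [/\ I 0, forall x y, I x -> I y -> I (x + y) & forall a x, I x -> I (a * x)].

Record filtration (R : comNzRingType) := Filtration {
  fil :> nat -> set R;
  fil_ideal : forall n, ideal (fil n);
  fil_top : fil 0 = setT;
  fil_decr : forall n, fil n.+1 `<=` fil n;
  fil_mul : forall m n x y, fil m x -> fil n y -> fil (m + n)%N (x * y)
}.

Section Adic.
Variables (R : comNzRingType) (a : R).

Definition adic_ideal (n : nat) : set R := [set x | exists r, x = r * a ^+ n].

Fact adic_is_ideal n : ideal (adic_ideal n).
Proof.
split=> [|x y [r ->] [s ->]|b x [r ->]].
- by exists 0; rewrite mul0r.
- by exists (r + s); rewrite mulrDl.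
- by exists (b * r); rewrite mulrA.
Qed.

Fact adic_top : adic_ideal 0 = setT.
Proof. by apply/seteqP; split=> // x _; exists x; rewrite expr0 mulr1. Qed.

Fact adic_decr n : adic_ideal n.+1 `<=` adic_ideal n.
Proof. by move=> x [r ->]; exists (r * a); rewrite exprS mulrA. Qed.

Fact adic_mul m n x y :
  adic_ideal m x -> adic_ideal n y -> adic_ideal (m + n)%N (x * y).
Proof. by move=> [r ->] [s ->]; exists (r * s); rewrite exprD mulrACA. Qed.

Definition adic : filtration R :=
  Filtration adic_is_ideal adic_top adic_decr adic_mul.

End Adic.
End Filtrations.

Section ElementarySymmetric.
Variable R : comNzRingType.

Lemma coef_prod1D (n : nat) (z : 'I_n -> R) (k : nat) :
  (\prod_(i < n) (1 + z i *: 'X))`_k = mmap intr z (mesym n int k).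
Proof.
have -> : \prod_(i < n) (1 + z i *: 'X) =
   \sum_(J in {set 'I_n}) (\prod_(i in J) z i) *: 'X^#|J|.
  under eq_bigr do rewrite addrC.
  rewrite bigA_distr; apply: eq_bigr => J _.
  by rewrite -big_mkcond /= scaler_prod prodr_const.
rewrite coef_sum rmorph_sum /= [RHS]big_mkcond /=.
apply: eq_bigr => J _; rewrite coefZ coefXn eq_sym.
case: eqP => _; rewrite ?mulr1 ?mulr0 // rmorph_prod /=.
by apply: eq_bigr => i _; rewrite mmapX mmap1U.
Qed.

End ElementarySymmetric.

(* The multiplication polynomial P_n lies in Z[X_1,..,X_n; Y_1,..,Y_n], the
   variable [lshift n i] being X_(i+1) and [rshift n j] being Y_(j+1).  It is
   determined by: P_n(e_1(x),..,e_n(x); e_1(y),..,e_n(y)) is the coefficient of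
   t^n in \prod_(i, j) (1 + x_i y_j t). *)
Definition mul_elem (n : nat) : (n + n).-tuple {mpoly int[n + n]} :=
  [tuple match split k with
         | inl i => mesym n int i.+1 \mPo [tuple 'X_(lshift n l) | l < n]
         | inr j => mesym n int j.+1 \mPo [tuple 'X_(rshift n l) | l < n]
         end | k < n + n].

Definition mul_poly_spec (n : nat) (P : {mpoly int[n + n]}) : Prop :=
  P \mPo mul_elem n =
  (\prod_(i < n) \prod_(j < n)
     (1 + ('X_(lshift n i) * 'X_(rshift n j)) *: 'X
      : {poly {mpoly int[n + n]}}))`_n.

(* The composition polynomial P_{m,n} in Z[X_1,..,X_(mn)] is determined by:
   P_{m,n}(e_1(x),..,e_(mn)(x)) is the coefficient of t^m in the product of the
   1 + x_(i_1)...x_(i_n) t over i_1 < ... < i_n. *)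
Definition comp_poly_spec (m n : nat) (P : {mpoly int[m * n]}) : Prop :=
  P \mPo [tuple mesym (m * n) int i.+1 | i < m * n] =
  (\prod_(J : {set 'I_(m * n)} | #|J| == n)
     (1 + (\prod_(i in J) 'X_i) *: 'X : {poly {mpoly int[m * n]}}))`_m.

Section Existence.

Lemma msym_coef (n : nat) (R : comNzRingType) (s : 'S_n)
    (Q : {poly {mpoly R[n]}}) k : msym s (Q`_k) = (map_poly (msym s) Q)`_k.
Proof. by rewrite coef_map. Qed.

Lemma msymXU (n : nat) (R : comNzRingType) (s : 'S_n) i :
  msym s ('X_i : {mpoly R[n]}) = 'X_(s i).
Proof.
rewrite msymX; congr 'X_[_]; apply/mnmP => j; rewrite !mnmE.
by rewrite -(inj_eq (@perm_inj _ s)) permKV.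
Qed.

Lemma rmorph_mmap (n : nat) (R S T : comNzRingType) (g : {rmorphism S -> T})
    (f : R -> S) (h : 'I_n -> S) p :
  g (mmap f h p) = mmap (g \o f) (g \o h) p.
Proof.
rewrite /mmap rmorph_sum /=; apply: eq_bigr => m _.
rewrite rmorphM /= /mmap1 rmorph_prod /=; congr (_ * _).
by apply: eq_bigr => i _; rewrite rmorphXn.
Qed.

Lemma mmap_ext (n : nat) (R S : comNzRingType) (f f' : R -> S)
    (h h' : 'I_n -> S) p : f =1 f' -> h =1 h' -> mmap f h p = mmap f' h' p.
Proof.
by move=> ff' hh'; apply: eq_bigr => m _; rewrite ff' (mmap1_eq _ hh').
Qed.

Lemma comp_poly_ex (m n : nat) : exists P, @comp_poly_spec m n P.
Proof.
rewrite /comp_poly_spec; set q := (X in exists P, _ = X`_m).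
have sym_q : q`_m \is symmetric.
  apply/issymP => s; rewrite msym_coef; congr (polyseq _)`_m.
  have injS : injective (fun J : {set 'I_(m * n)} => (s @: J)%SET).
    exact/imset_inj/perm_inj.
  rewrite /q rmorph_prod /= [RHS](reindex_inj injS) /=.
  apply: eq_big => [J|J _]; first by rewrite card_imset //; exact: perm_inj.
  rewrite rmorphD rmorph1 /= map_polyZ map_polyX /= rmorph_prod /=.
  rewrite big_imset /=; last by move=> i j _ _; exact: perm_inj.
  by congr (_ + _ *: _); apply: eq_bigr => i _; rewrite msymXU.
by have [P [<- _]] := sym_fundamental sym_q; exists P.
Qed.

Lemma mul_poly_ex (n : nat) : exists P, @mul_poly_spec n P.
Proof.
pose Y (k : nat) : {mpoly int[n]} :=
  if k is j.+1 then (if insub j is Some i then 'X_i else 0) else 1.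
pose q : {poly {mpoly {mpoly int[n]}[n]}} :=
  \prod_(i < n) \sum_(k < n.+1) (Y k *: 'X_i ^+ k) *: 'X^k.
have sym_q : q`_n \is symmetric.
  apply/issymP => s; rewrite msym_coef; congr (polyseq _)`_n.
  rewrite /q rmorph_prod /= [RHS](reindex_inj (@perm_inj _ s)) /=.
  apply: eq_bigr => i _; rewrite rmorph_sum /=; apply: eq_bigr => k _.
  by rewrite map_polyZ map_polyXn /= msymZ rmorphXn /= msymXU.
have [T [TE _]] := sym_fundamental sym_q.
pose vy := [tuple ('X_(rshift n l) : {mpoly int[n + n]}) | l < n].
pose vx := [tuple ('X_(lshift n l) : {mpoly int[n + n]}) | l < n].
pose ey := [tuple mesym n int j.+1 \mPo vy | j < n].
pose chi : {rmorphism {mpoly {mpoly int[n]}[n]} -> {mpoly int[n + n]}} :=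
  mmap (comp_mpoly ey) (fun i => 'X_(lshift n i)).
exists (mmap (comp_mpoly vy) (fun i => 'X_(lshift n i)) T); rewrite /mul_poly_spec.
have -> : mmap (comp_mpoly vy) (fun i => 'X_(lshift n i)) T \mPo mul_elem n
          = chi (T \mPo [tuple mesym n _ i.+1 | i < n]).
  rewrite [RHS]rmorph_mmap [LHS]rmorph_mmap; apply: mmap_ext => [c|i] /=.
    rewrite mmapC [LHS]rmorph_mmap; apply: mmap_ext => [z|j] /=.
      by rewrite comp_mpolyC.
    rewrite !tnth_mktuple comp_mpolyXU -tnth_nth tnth_mktuple.
    by rewrite (unsplitK (inr j)).
  rewrite comp_mpolyXU -tnth_nth !tnth_mktuple (unsplitK (inl i)).
  rewrite /mesym !rmorph_sum; apply: eq_bigr => J _.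
  rewrite !rmorph_prod; apply: eq_bigr => j _ /=.
  by rewrite comp_mpolyXU -tnth_nth tnth_mktuple mmapX mmap1U.
rewrite TE -coef_map; congr (polyseq _)`_n.
rewrite /q rmorph_prod /=; apply: eq_bigr => i _.
apply/polyP => k; rewrite coef_prod1D rmorph_sum /= coef_sum.
have -> : mmap intr (fun j => 'X_(lshift n i) * 'X_(rshift n j))
            (mesym n int k) = 'X_(lshift n i) ^+ k * (mesym n int k \mPo vy).
  rewrite /mesym !rmorph_sum mulr_sumr; apply: eq_bigr => J /eqP <-.
  rewrite !rmorph_prod -prodr_const -big_split; apply: eq_bigr => j _ /=.
  by rewrite comp_mpolyXU -tnth_nth tnth_mktuple mmapX mmap1U.
under eq_bigr do rewrite map_polyZ map_polyXn coefZ coefXn /chi /= mmapZ rmorphXn /=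
  mmapX mmap1U.
have [lt_kn|le_nk] := ltnP k n.+1; last first.
  rewrite mesym_geqnE // raddf0 mulr0 big1 // => l _.
  by rewrite gtn_eqF ?mulr0 // (leq_trans (ltn_ord l)).
rewrite (bigD1 (Ordinal lt_kn)) //= eqxx mulr1 big1 ?addr0 => [|l]; last first.
  by rewrite -val_eqE eq_sym /= => /negPf->; rewrite mulr0.
rewrite mulrC; congr (_ * _).
case: k lt_kn => [|k] lt_kn; first by rewrite mesym0E !rmorph1.
rewrite /= insubT /= comp_mpolyXU -tnth_nth tnth_mktuple.
by [].
Qed.

End Existence.

Section Uniqueness.

Lemma comp_poly_unique (m n : nat) P Q :
  @comp_poly_spec m n P -> @comp_poly_spec m n Q -> P = Q.
Proof. by move=> PE QE; apply: msym_fundamental_un; rewrite PE QE. Qed.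

Lemma int_morph_eq (R : comNzRingType) (f g : {rmorphism int -> R}) : f =1 g.
Proof. by move=> z; rewrite -[z]intz !rmorph_int. Qed.

Lemma comp_mesym (n m k : nat) (R : comNzRingType) (w : n.-tuple {mpoly R[m]}) :
  mesym n R k \mPo w =
  \sum_(J : {set 'I_n} | #|J| == k) \prod_(i in J) tnth w i.
Proof.
rewrite rmorph_sum; apply: eq_bigr => J _.
by rewrite rmorph_prod; apply: eq_bigr => i _; rewrite [LHS]comp_mpolyXU -tnth_nth.
Qed.

Lemma comp_mul_elem_inj (n : nat) (P : {mpoly int[n + n]}) :
  P \mPo mul_elem n = 0 -> P = 0.
Proof.
pose nest : {rmorphism {mpoly int[n + n]} -> {mpoly {mpoly int[n]}[n]}} :=
  mmap intr (fun k => match split k with inl i => 'X_i | inr j => ('X_j)%:MP end).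
pose flat : {rmorphism {mpoly {mpoly int[n]}[n]} -> {mpoly int[n + n]}} :=
  mmap (comp_mpoly [tuple 'X_(rshift n l) | l < n]) (fun i => 'X_(lshift n i)).
pose ey := [tuple mesym n int j.+1 | j < n].
have nestK p : flat (nest p) = p.
  rewrite [LHS]rmorph_mmap -[RHS]comp_mpoly_id; apply: mmap_ext => [z|k].
    exact: int_morph_eq.
  rewrite tnth_mktuple /= -{2}(splitK k); case: (split k) => i /=.
    by rewrite mmapX mmap1U.
  by rewrite mmapC [LHS]comp_mpolyXU -tnth_nth tnth_mktuple.
move=> P0; suff nP0 : nest P = 0 by rewrite -(nestK P) nP0 rmorph0.
have nestE : nest (P \mPo mul_elem n) =
    map_mpoly (comp_mpoly ey) (nest P) \mPo [tuple mesym n _ i.+1 | i < n].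
  rewrite [nest (_ \mPo _)]rmorph_mmap.
  pose sub : {rmorphism {mpoly {mpoly int[n]}[n]} -> {mpoly {mpoly int[n]}[n]}} :=
    comp_mpoly [tuple mesym n {mpoly int[n]} i.+1 | i < n]
      \o map_mpoly (comp_mpoly ey).
  rewrite -[RHS]/(sub (nest P)) [RHS]rmorph_mmap; apply: mmap_ext => [z|k].
    exact: int_morph_eq.
  rewrite /= tnth_mktuple; case: (split k) => i.
    rewrite map_mpolyX comp_mpolyXU -tnth_nth tnth_mktuple.
    rewrite comp_mesym rmorph_sum; apply: eq_bigr => J _.
    rewrite rmorph_prod; apply: eq_bigr => j _.
    by rewrite tnth_mktuple /= mmapX mmap1U (unsplitK (inl j)).
  transitivity ((mesym n int i.+1)%:MP : {mpoly {mpoly int[n]}[n]}); last first.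
    rewrite map_mpolyC comp_mpolyC; congr (_%:MP).
    by rewrite [RHS]comp_mpolyXU -tnth_nth tnth_mktuple.
  rewrite comp_mesym rmorph_sum [mesym _ _ _]/mesym rmorph_sum.
  apply: eq_bigr => J _; rewrite !rmorph_prod; apply: eq_bigr => j _.
  by rewrite tnth_mktuple /= mmapX mmap1U (unsplitK (inr j)).
move: nestE; rewrite P0 rmorph0 => /esym /msym_fundamental_un0 nP0.
apply/mpolyP => m; have := congr1 (mcoeff m) nP0.
by rewrite mcoeff_map_mpoly !mcoeff0 => /msym_fundamental_un0.
Qed.

Lemma mul_poly_unique (n : nat) P Q :
  @mul_poly_spec n P -> @mul_poly_spec n Q -> P = Q.
Proof.
move=> PE QE; apply/eqP; rewrite -subr_eq0; apply/eqP/comp_mul_elem_inj.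
by rewrite comp_mpolyB PE QE subrr.
Qed.

End Uniqueness.

Definition mul_poly (n : nat) : {mpoly int[n + n]} := sval (cid (mul_poly_ex n)).

Lemma mul_polyP (n : nat) : mul_poly_spec (mul_poly n).
Proof. exact: svalP (cid (mul_poly_ex n)). Qed.

Definition comp_poly (m n : nat) : {mpoly int[m * n]} :=
  sval (cid (comp_poly_ex m n)).

Lemma comp_polyP (m n : nat) : comp_poly_spec (comp_poly m n).
Proof. exact: svalP (cid (comp_poly_ex m n)). Qed.

Definition lambda_mul_args (R : comNzRingType) (lam : nat -> R -> R)
    (n : nat) (x y : R) (k : 'I_(n + n)) : R :=
  match split k with inl i => lam i.+1 x | inr j => lam j.+1 y end.

Record lambda_structure (R : comNzRingType) (lam : nat -> R -> R) : Prop := {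
  lambda_0 : forall x, lam 0%N x = 1;
  lambda_1 : forall x, lam 1%N x = x;
  lambda_one : forall n, (1 < n)%N -> lam n 1 = 0;
  lambda_add : forall n x y,
    lam n (x + y) = \sum_(i < n.+1) lam i x * lam (n - i)%N y;
  lambda_mul : forall n x y,
    lam n (x * y) = mmap intr (lambda_mul_args lam x y) (mul_poly n);
  lambda_comp : forall m n x,
    lam m (lam n x) = mmap intr (fun i => lam i.+1 x) (comp_poly m n)
}.

Record filtered_lambda (R : comNzRingType) (F : filtration R)
    (lam : nat -> R -> R) : Prop := {
  filtered_lambda_structure : lambda_structure lam;
  filtered_lambda_closed : forall i n x, (0 < i)%N -> F n x -> F n (lam i x)
}.

Definition filtered_lambda_map (R S : comNzRingType)
    (F : filtration R) (lamR : nat -> R -> R)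
    (G : filtration S) (lamS : nat -> S -> S) (f : {rmorphism R -> S}) : Prop :=
  (forall n x, F n x -> G n (f x)) /\
  (forall i x, f (lamR i x) = lamS i (f x)).

Definition filtered_lambda_iso (R : comNzRingType) (F : filtration R)
    (lam lam' : nat -> R -> R) : Prop :=
  exists f g : {rmorphism R -> R},
    [/\ filtered_lambda_map F lam F lam' f, filtered_lambda_map F lam' F lam g,
        cancel f g & cancel g f].

Definition uncountably_many_filtered_lambda (R : comNzRingType)
    (F : filtration R) : Prop :=
  exists L : set (nat -> R -> R),
    [/\ forall lam, L lam -> filtered_lambda F lam,
        forall lam lam', L lam -> L lam' -> filtered_lambda_iso F lam lam' ->
          lam = lam'
      & ~ countable L].

(* [{poly %/ h}] replaces [h] by 'X unless [h] is monic of positive degree, so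
   this is A[x]/x^N for N > 0 only. *)
Notation truncated_poly A N := {poly %/ ('X^N : {poly A})}.
Notation truncated_x A N := ('qX : truncated_poly A N).

Notation dual_numbers B := (truncated_poly B 2).
Notation eps B := (truncated_x B 2).

Lemma truncated_x_pow (A : comNzRingType) (N : nat) :
  (0 < N)%N -> truncated_x A N ^+ N = 0.
Proof.
move=> N_gt0; rewrite -rmorphXn; apply: val_inj.
by rewrite /= mk_monic_Xn prednK // Pdiv.RingMonic.rmodpp ?monicXn.
Qed.

Lemma eps_adicE (B : comNzRingType) (n : nat) :
  (1 < n)%N -> adic (eps B) n = [set 0]%classic.
Proof.
move=> n_gt1; apply/seteqP; split=> [x [r ->]|x ->]; last first.
  by exists 0; rewrite mul0r.
by rewrite -(subnK n_gt1) exprD truncated_x_pow // !mulr0.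
Qed.

Record powser (A : Type) := PowSer { pcoef : nat -> A }.

Lemma powserP (A : Type) (f g : powser A) : pcoef f =1 pcoef g -> f = g.
Proof. by case: f g => [f] [g] /= /funext ->. Qed.

HB.instance Definition _ (A : Type) := gen_eqMixin (powser A).
HB.instance Definition _ (A : Type) := gen_choiceMixin (powser A).

Section PowerSeriesRing.
Variable A : comNzRingType.
Implicit Types f g h : powser A.

Definition powser0 : powser A := PowSer (fun=> 0).
Definition powser1 : powser A := PowSer (fun n => (n == 0)%:R).
Definition powserX : powser A := PowSer (fun n => (n == 1)%:R).
Definition powserN f : powser A := PowSer (fun n => - pcoef f n).
Definition powserD f g : powser A := PowSer (fun n => pcoef f n + pcoef g n).
Definition powserM f g : powser A :=
  PowSer (fun n => \sum_(i < n.+1) pcoef f i * pcoef g (n - i)%N).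

Fact powserDA : associative powserD.
Proof. by move=> f g h; apply: powserP => n /=; rewrite addrA. Qed.
Fact powserDC : commutative powserD.
Proof. by move=> f g; apply: powserP => n /=; rewrite addrC. Qed.
Fact powser0D : left_id powser0 powserD.
Proof. by move=> f; apply: powserP => n /=; rewrite add0r. Qed.
Fact powserND : left_inverse powser0 powserN powserD.
Proof. by move=> f; apply: powserP => n /=; rewrite addNr. Qed.

HB.instance Definition _ := GRing.isZmodule.Build (powser A)
  powserDA powserDC powser0D powserND.

Let trunc n f : {poly A} := \poly_(i < n) pcoef f i.

Let coef_trunc n f i : (i < n)%N -> (trunc n f)`_i = pcoef f i.
Proof. by rewrite coef_poly => ->. Qed.

Let coef_truncM n k f g : (k < n)%N ->
  (trunc n f * trunc n g)`_k = pcoef (powserM f g) k.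
Proof.
move=> lt_kn; rewrite coefM; apply: eq_bigr => i _.
rewrite !coef_trunc //; last by rewrite (leq_ltn_trans _ lt_kn) // -ltnS.
by rewrite (leq_ltn_trans _ lt_kn) // leq_subr.
Qed.

Fact powserMA : associative powserM.
Proof.
move=> f g h; apply: powserP => n.
pose t := trunc n.+1.
have -> : pcoef (powserM f (powserM g h)) n = (t f * (t g * t h))`_n.
  rewrite coefM; apply: eq_bigr => i _.
  by rewrite coef_trunc ?ltn_ord // coef_truncM // ltnS leq_subr.
rewrite mulrA coefM; apply: eq_bigr => i _.
by rewrite coef_truncM ?ltn_ord // coef_trunc // ltnS leq_subr.
Qed.

Fact powserMC : commutative powserM.
Proof.
by move=> f g; apply: powserP => n; rewrite -!(@coef_truncM n.+1) // mulrC.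
Qed.

Fact powser1M : left_id powser1 powserM.
Proof.
move=> f; apply: powserP => n /=.
rewrite big_ord_recl /= mul1r subn0 big1 ?addr0 // => i _.
by rewrite mul0r.
Qed.

Fact powserMDl : left_distributive powserM powserD.
Proof.
move=> f g h; apply: powserP => n /=.
by rewrite -big_split; apply: eq_bigr => i _; rewrite mulrDl.
Qed.

Fact powser1_neq0 : powser1 != 0.
Proof.
by apply/eqP => /(congr1 (fun f => pcoef f 0)) /eqP; rewrite oner_eq0.
Qed.

HB.instance Definition _ := GRing.Zmodule_isComNzRing.Build (powser A)
  powserMA powserMC powser1M powserMDl powser1_neq0.

End PowerSeriesRing.

(* Main.v *)
(* Over a torsion-free ring, Newton's identities turn a family of commuting
   ring endomorphisms psi^k into at most one family of operations lambda^n, and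
   such a family is a lambda-structure: in the polynomial ring of the
   lambda-variables, which embeds in the ring of roots, n! e_n is an integral
   polynomial in the power sums, so the identities for products and
   compositions reduce to psi^k(xy) = psi^k(x) psi^k(y) and
   psi^k psi^l = psi^(kl).

   Given a set S of primes, let a_k = k if all the prime factors of k are in S
   and a_k = 0 otherwise, and let psi^k be the substitution x -> a_k x. Newton's
   identities are solvable over a Q-algebra by division. On B[epsilon] they are
   solved by lambda_t(b + c epsilon) =
   (1 + t)^b (1 + c epsilon \sum_k (-1)^(k-1) (a_k / k) t^k).
   A filtered isomorphism commutes with the psi^k, and comparing the
   coefficients of x in psi^k(f(x)) = f(psi^k(x)) recovers a_k, hence S. *)
Require Import Defs.
From HB Require Import structures.
From mathcomp Require Import all_boot all_order all_algebra.
From mathcomp Require Import perm qpoly.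
From mathcomp Require Import boolp classical_sets cardinality.
From mathcomp Require Import mpoly.

Set Implicit Arguments.
Unset Strict Implicit.
Unset Printing Implicit Defensive.
Import GRing.Theory.
Local Open Scope ring_scope.

(** * Newton's identities *)

Definition newton (R : comNzRingType) (n : nat) (e p : nat -> R) : Prop :=
  e 0%N = 1 /\
  forall m, (m < n)%N ->
    e m.+1 *+ m.+1 = \sum_(k < m.+1) (-1) ^+ k * (p k.+1 * e (m - k)%N).

Lemma strong_rec_exists (T : Type) (F : nat -> (nat -> T) -> T) (t0 : T) :
  (forall n u v, (forall k, (k < n)%N -> u k = v k) -> F n u = F n v) ->
  exists u, forall n, u n = F n u.
Proof.
move=> F_ext.
(* [w n] holds the first [n] values already computed and [t0] beyond, so the sequence is read off as
   [w n.+1 n]. *)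
pose w := fix w n := if n is m.+1 then
  (fun k => if k == m then F m (w m) else w m k) else (fun=> t0).
exists (fun n => w n.+1 n) => n /=; rewrite eqxx.
apply: F_ext => k; elim: n => //= n IHn; rewrite ltnS leq_eqVlt.
by have [->|_ /IHn] := eqVneq k n; first rewrite eqxx.
Qed.

Lemma newton_ext (R : comNzRingType) n (e e' p p' : nat -> R) :
  (forall k, (k <= n)%N -> e k = e' k) ->
  (forall k, (0 < k <= n)%N -> p k = p' k) ->
  newton n e p -> newton n e' p'.
Proof.
move=> ee' pp' [e0 eS]; split=> [|m lt_mn]; first by rewrite -ee'.
rewrite -ee' // eS //; apply: eq_bigr => k _.
rewrite pp' ?ee' ?(leq_trans (ltn_ord k)) //.
by rewrite (leq_trans (leq_subr _ _)) // ltnW.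
Qed.

Lemma newton_map (R S : comNzRingType) (f : {rmorphism R -> S}) n e p :
  newton n e p -> newton n (f \o e) (f \o p).
Proof.
move=> [e0 eS]; split=> [|m lt_mn] /=; first by rewrite e0 rmorph1.
rewrite -rmorphMn eS // rmorph_sum; apply: eq_bigr => k _.
by rewrite rmorphMsign rmorphM.
Qed.

(** The unknown p_n occurs in the n-th identity with coefficient 1 or -1, since e_0 = 1, so it is
    solved for without division. The same reason gives uniqueness over any ring. *)
Lemma power_sums_exist (R : comNzRingType) (e : nat -> R) :
  e 0%N = 1 -> exists p, forall n, newton n e p.
Proof.
move=> e0.
pose F n (u : nat -> R) := (-1) ^+ n.-1 *
  (e n *+ n - \sum_(k < n.-1) (-1) ^+ k * (u k.+1 * e (n.-1 - k)%N)).
have [n u v uv|p pE] := @strong_rec_exists R F 0.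
  rewrite /F; congr (_ * (_ - _)); apply: eq_bigr => k _; rewrite uv //.
  by case: n uv k => [|n] _ [].
exists p => n; split=> // m _; rewrite big_ord_recr /= pE /F /= subnn e0 mulr1.
by rewrite mulrA -expr2 sqrr_sign mul1r addrC subrK.
Qed.

Lemma power_sums_unique (R : comNzRingType) n (e p q : nat -> R) :
  newton n e p -> newton n e q -> forall k, (0 < k <= n)%N -> p k = q k.
Proof.
move=> [e0 ep] [_ eq] k; elim/ltn_ind: k => -[//|k] IHk /= lt_kn.
have := ep _ lt_kn; rewrite eq // !big_ord_recr /= subnn e0 !mulr1.
under eq_bigr => i _.
  rewrite -IHk ?(leq_trans _ lt_kn) ?ltnS //; last exact: ltnW.
  over.
by move/addrI/(can_inj (signrMK _)).
Qed.

(** Multiplying the identity of degree m + 1 by m! gives a recursion for the elements j! e_j with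
    the integer coefficients m!/(m - k)!. It involves [p] alone, so one [g] serves for every [f]. *)
Lemma scaled_elementary_exist (U : comNzRingType) (p : nat -> U) :
  exists g : nat -> U, forall (R : comNzRingType) (f : {rmorphism U -> R}) n e,
    newton n e (f \o p) -> f (g n) = e n *+ n`!.
Proof.
pose F n (u : nat -> U) := if n is m.+1 then
  \sum_(k < m.+1) (-1) ^+ k * (p k.+1 * u (m - k)%N) *+ m ^_ k else 1.
have [[|n] u v uv|g gE] := @strong_rec_exists U F 0; first by [].
  apply: eq_bigr => k _; rewrite uv // ltnS leq_subr //.
exists g => R f n e [e0 eS].
suff H m : (m <= n)%N -> f (g m) = e m *+ m`! by exact: H.
elim/ltn_ind: m => -[|m] IHm le_mn; rewrite gE /=; first by rewrite rmorph1 e0.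
rewrite factS mulrnA eS // rmorph_sum -sumrMnl; apply: eq_bigr => k _.
have le_km: (k <= m)%N by rewrite -ltnS.
rewrite rmorphMn rmorphMsign rmorphM IHm ?ltnS ?leq_subr //; last first.
  by rewrite (leq_trans (leq_subr _ _)) // ltnW.
by rewrite -(ffact_fact le_km) mulnC mulrnA !mulrnAr.
Qed.

(* [n! e_n] is an integral polynomial in the power sums, so an element [P]
   whose image in the ring of roots is [e_n] can be recovered from them
   without dividing in [U]. *)
Lemma newton_transfer (U S R : comNzRingType) (iota : {rmorphism U -> S})
    (phi : {rmorphism U -> R}) (p : nat -> U) n (P : U) e l :
  injective iota -> Ztorsionfree R ->
  newton n e (iota \o p) -> newton n l (phi \o p) -> iota P = e n ->
  phi P = l n.
Proof.
move=> inj_iota tfR ne nl PE; have [g gE] := scaled_elementary_exist p.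
have gP : g n = P *+ n`!.
  by apply: inj_iota; rewrite (gE _ _ _ _ ne) rmorphMn PE.
apply/eqP; rewrite -subr_eq0; apply/eqP/(tfR n`!); first exact: fact_gt0.
by rewrite mulrnBl -(gE _ _ _ _ nl) gP rmorphMn subrr.
Qed.

Lemma newton_unique (R : comNzRingType) n (e f p : nat -> R) :
  Ztorsionfree R -> newton n e p -> newton n f p -> e n = f n.
Proof.
move=> tfR ne nf.
by apply: (@newton_transfer R R R idfun idfun p n (e n) e f) => //; exact: inj_id.
Qed.

(** In all degrees together the identities say E' = L E, where E is the generating series of [e] and
    L, with coefficients (-1)^k p_(k+1), is its logarithmic derivative, which turns products into
    sums. *)
Lemma newton_mul (R : comNzRingType) (e f p q : nat -> R) :
  (forall n, newton n e p) -> (forall n, newton n f q) ->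
  forall n, newton n (fun n => \sum_(i < n.+1) e i * f (n - i)%N)
                     (fun k => p k + q k).
Proof.
pose D (u : powser R) := PowSer (fun n => pcoef u n.+1 *+ n.+1).
pose L (u : nat -> R) := PowSer (fun k => (-1) ^+ k * u k.+1).
have DM (u v : powser R) : D (u * v) = D u * v + u * D v.
  apply: powserP => n /=; transitivity
    (\sum_(i < n.+2) (pcoef u i *+ i * pcoef v (n.+1 - i) +
       pcoef u i * (pcoef v (n.+1 - i) *+ (n.+1 - i)))); last first.
    rewrite big_split /=; congr (_ + _).
      by rewrite big_ord_recl /= mulr0n mul0r add0r.
    rewrite big_ord_recr /= subnn mulr0n mulr0 addr0.
    by apply: eq_bigr => i _; rewrite subSn // -ltnS.
  rewrite -sumrMnl; apply: eq_bigr => i _.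
  by rewrite mulrnAl mulrnAr -mulrnDr subnKC // -ltnS.
have newtonE u r : (forall n, newton n u r) <->
    u 0%N = 1 /\ D (PowSer u) = L r * PowSer u.
  split=> [nu|[u0 uE] n].
    split; first by case: (nu 0%N).
    apply: powserP => n /=; rewrite (nu n.+1).2 //.
    by apply: eq_bigr => i _; rewrite mulrA.
  split=> // m _; have /= -> := congr1 (fun w => pcoef w m) uE.
  by apply: eq_bigr => i _; rewrite mulrA.
move=> /newtonE[e0 eE] /newtonE[f0 fE]; apply/newtonE.
split; first by rewrite big_ord1 e0 f0 mul1r.
rewrite -[PowSer _]/(PowSer e * PowSer f) DM eE fE.
have -> : L (fun k => p k + q k) = L p + L q.
  by apply: powserP => k /=; rewrite mulrDr.
by rewrite -mulrA (mulrCA (PowSer e)) -mulrDl.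
Qed.

Lemma newton_one_root (R : comNzRingType) (z : R) n :
  newton n (fun k => (1 + z *: 'X)`_k) (fun k => z ^+ k).
Proof.
have E k : (1 + z *: 'X)`_k = if k is k'.+1 then z *+ (k' == 0)%N else 1.
  rewrite coefD coef1 coefZ coefX mulr_natr.
  by case: k => [|k]; rewrite ?addr0 ?add0r.
split=> [|[|m] _]; rewrite E //.
  by rewrite big_ord1 mul1r E mulr1.
(* The sequence vanishes beyond degree 1, so only the last two terms remain, and they are
   opposite. *)
rewrite mulr0n mul0rn 2!big_ord_recr /= subnn subSnn big1 ?add0r => [|i _].
  by rewrite !E mulr1 -exprSr [(-1) ^+ m.+1]exprS mulN1r mulNr subrr.
by rewrite subSn 1?ltnW // E subn_eq0 leqNgt ltn_ord !mulr0.
Qed.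

Lemma newton_roots (R : comNzRingType) (I : Type) (r : seq I) (P : pred I)
    (z : I -> R) n :
  newton n (fun k => (\prod_(i <- r | P i) (1 + z i *: 'X))`_k)
           (fun k => \sum_(i <- r | P i) z i ^+ k).
Proof.
elim: r n => [|i r IHr] n.
  split=> [|m _]; first by rewrite big_nil coef1.
  rewrite big_nil coef1 mul0rn big1 // => k _.
  by rewrite big_nil mul0r mulr0.
case Pi: (P i); last first.
  by apply: newton_ext (IHr n) => k _; rewrite big_cons Pi.
apply: newton_ext (newton_mul (newton_one_root (z i)) IHr n) => k _.
  by rewrite big_cons Pi coefM.
by rewrite big_cons Pi.
Qed.

(** * Power sums as polynomials in the elementary symmetric functions *)

(** The value 0 past n matches the vanishing of e_k of n roots for k > n. *)
Definition elem_seq (R : comNzRingType) n (z : 'I_n -> R) (k : nat) : R :=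
  if k is j.+1 then oapp z 0 (insub j) else 1.

Lemma elem_seq_ext (R : comNzRingType) n (z w : 'I_n -> R) k :
  z =1 w -> elem_seq z k = elem_seq w k.
Proof. by move/funext->. Qed.

Lemma elem_seq_map (R S : comNzRingType) (f : {rmorphism R -> S}) n
    (z : 'I_n -> R) k : f (elem_seq z k) = elem_seq (f \o z) k.
Proof.
case: k => [|k] /=; rewrite ?rmorph1 //.
by case: insub => /= [//|]; rewrite rmorph0.
Qed.

Lemma elem_seq_small (R : comNzRingType) n (z : 'I_n -> R) (u : nat -> R) k :
  u 0%N = 1 -> (forall i : 'I_n, z i = u i.+1) -> (k <= n)%N ->
  elem_seq z k = u k.
Proof. by move=> u0 zu; case: k => [//|k] lt_kn /=; rewrite insubT /= zu. Qed.

Lemma elem_seq_roots (R : comNzRingType) n (x : 'I_n -> R) k :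
  elem_seq (fun i : 'I_n => mmap intr x (mesym n int i.+1)) k =
  (\prod_(i < n) (1 + x i *: 'X))`_k.
Proof.
rewrite coef_prod1D; case: k => [|k] /=; first by rewrite mesym0E rmorph1.
case: insubP => [i _ <- //|]; rewrite -leqNgt => le_nk.
by rewrite mesym_geqnE ?rmorph0.
Qed.

Lemma mmap_intr_comp (n m : nat) (R : comNzRingType) (w : n.-tuple {mpoly int[m]})
    (x : 'I_m -> R) p :
  mmap intr x (p \mPo w) = mmap intr (fun i => mmap intr x (tnth w i)) p.
Proof.
rewrite [LHS]rmorph_mmap; apply: mmap_ext => // z /=.
by rewrite mmapC.
Qed.

Lemma comp_mpoly_comp n m l (p : {mpoly int[n]}) (w : n.-tuple {mpoly int[m]})
    (v : m.-tuple {mpoly int[l]}) :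
  (p \mPo w) \mPo v = p \mPo [tuple tnth w i \mPo v | i < n].
Proof.
rewrite [LHS]rmorph_mmap; apply: mmap_ext => [z|i] /=; first exact: comp_mpolyC.
by rewrite tnth_mktuple.
Qed.

Lemma mmap_intr_id n (p : {mpoly int[n]}) : mmap intr (fun i => 'X_i) p = p.
Proof.
rewrite -[RHS]comp_mpoly_id; apply: mmap_ext => [|i]; last by rewrite tnth_mktuple.
exact: int_morph_eq.
Qed.

(** [p] solves Newton's identities with the variables as elementary symmetric functions, and
    uniqueness of power sums identifies its specializations. For an arbitrary sequence [e] the
    comparison stops at degree n, where the variables run out. *)
Lemma mesym_power_sums n : exists p : nat -> {mpoly int[n]},
  (forall k, (0 < k)%N ->
    p k \mPo [tuple mesym n int i.+1 | i < n] = \sum_(i < n) 'X_i ^+ k) /\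
  (forall (R : comNzRingType) (e q : nat -> R), (forall m, newton m e q) ->
    forall k, (0 < k <= n)%N -> mmap intr (fun i : 'I_n => e i.+1) (p k) = q k).
Proof.
have [//|p np] := @power_sums_exist {mpoly int[n]} (elem_seq (fun i => 'X_i)).
exists p; split=> [k k_gt0|R e q neq k /[dup] k_bd /andP[k_gt0 le_kn]].
  apply: (@power_sums_unique _ k _ (comp_mpoly [tuple mesym n int i.+1 | i < n] \o p)
    (fun k => \sum_(i < n) 'X_i ^+ k) _ _ k); last by rewrite k_gt0 leqnn.
    exact: newton_map (np k).
  apply: newton_ext (newton_roots _ _ _ k) => // j _ /=.
  rewrite elem_seq_map -elem_seq_roots; apply: elem_seq_ext => i.
  by rewrite [RHS]comp_mpolyXU -tnth_nth tnth_mktuple mmap_intr_id.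
pose phi : {rmorphism {mpoly int[n]} -> R} := mmap intr (fun i => e i.+1).
apply: (@power_sums_unique _ k e (phi \o p) q _ (neq k)); last first.
  by rewrite k_gt0 leqnn.
apply: newton_ext (newton_map phi (np k)) => // j le_jk /=.
rewrite elem_seq_map; apply: elem_seq_small => [|i|]; last exact: leq_trans le_kn.
  by case: (neq 0%N).
by rewrite /= mmapX mmap1U.
Qed.

(** * From Adams operations to a lambda-structure *)

Definition lambda_of_adams (R : comNzRingType) (psi : nat -> R -> R)
    (lam : nat -> R -> R) : Prop :=
  forall n x, newton n (lam^~ x) (psi^~ x).

Section Wilkerson.
Variables (R : comNzRingType) (psi : nat -> {rmorphism R -> R}).
Variable lam : nat -> R -> R.
Hypothesis tfR : Ztorsionfree R.
Hypothesis psi1 : forall x, psi 1 x = x.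
Hypothesis psiM : forall m n x, (0 < m)%N -> (0 < n)%N ->
  psi (m * n)%N x = psi m (psi n x).
Hypothesis lam_psi : lambda_of_adams psi lam.

(** Under [iota] the variables become elementary symmetric functions of two sets of roots, and [q k]
    the k-th power sum of the products x_i y_j. Under [phi] they become the operations on x and y,
    and [q k] becomes psi^k(x) psi^k(y) for 0 < k <= n. *)
Lemma adams_lambda_mul n x y :
  lam n (x * y) = mmap intr (lambda_mul_args lam x y) (Defs.mul_poly n).
Proof.
have [p [p_roots p_psi]] := mesym_power_sums n.
pose U := {mpoly int[n + n]}.
pose iota : {rmorphism U -> U} := comp_mpoly (mul_elem n).
pose phi : {rmorphism U -> R} := mmap intr (lambda_mul_args lam x y).
pose lft : {rmorphism {mpoly int[n]} -> U} :=
  comp_mpoly [tuple 'X_(lshift n l) | l < n].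
pose rgt : {rmorphism {mpoly int[n]} -> U} :=
  comp_mpoly [tuple 'X_(rshift n l) | l < n].
pose q k : U := lft (p k) * rgt (p k).
pose z (ij : 'I_n * 'I_n) : U := 'X_(lshift n ij.1) * 'X_(rshift n ij.2).
have inj_iota : injective iota.
  move=> P Q PQ; apply/eqP; rewrite -subr_eq0; apply/eqP/comp_mul_elem_inj.
  by rewrite comp_mpolyB; apply/eqP; rewrite subr_eq0; apply/eqP.
apply/esym.
have -> : mmap intr (lambda_mul_args lam x y) (Defs.mul_poly n) =
  phi (Defs.mul_poly n) by [].
apply: (@newton_transfer _ _ _ iota phi q n (Defs.mul_poly n)
  (fun k => (\prod_(ij in predT) (1 + z ij *: 'X))`_k) (lam^~ (x * y)) inj_iota tfR).
- apply: newton_ext (newton_roots _ _ _ n) => // k /andP[k_gt0 le_kn] /=.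
  have iota_side (v : n.-tuple U) :
      (forall i, iota (tnth v i) = mesym n int i.+1 \mPo v) ->
      iota (p k \mPo v) = (\sum_(i < n) 'X_i ^+ k) \mPo v.
    move=> vE; rewrite -p_roots // [LHS]comp_mpoly_comp [RHS]comp_mpoly_comp.
    congr (_ \mPo _); apply: eq_from_tnth => i.
    by rewrite !tnth_mktuple [LHS]vE.
  have sumE (h : 'I_n -> 'I_(n + n)) :
      (\sum_(i < n) 'X_i ^+ k) \mPo [tuple 'X_(h l) | l < n] =
      \sum_(i < n) 'X_(h i) ^+ k :> U.
    rewrite rmorph_sum; apply: eq_bigr => i _.
    by rewrite rmorphXn /= comp_mpolyXU -tnth_nth tnth_mktuple.
  have iota_lft : iota (lft (p k)) = \sum_(i < n) 'X_(lshift n i) ^+ k.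
    rewrite -sumE; apply: iota_side => i.
    rewrite tnth_mktuple [LHS]comp_mpolyXU -tnth_nth tnth_mktuple.
    by rewrite (unsplitK (inl i)).
  have iota_rgt : iota (rgt (p k)) = \sum_(i < n) 'X_(rshift n i) ^+ k.
    rewrite -sumE; apply: iota_side => i.
    rewrite tnth_mktuple [LHS]comp_mpolyXU -tnth_nth tnth_mktuple.
    by rewrite (unsplitK (inr i)).
  apply: etrans (etrans (congr2 *%R (esym iota_lft) (esym iota_rgt))
                        (esym (rmorphM iota _ _))).
  rewrite mulr_suml.
  under [RHS]eq_bigr do rewrite mulr_sumr.
  by rewrite pair_big /=; apply: eq_bigr => ij _; rewrite exprMn.
- apply: newton_ext (lam_psi n (x * y)) => // k k_bd /=.
  rewrite rmorphM [RHS](rmorphM phi); congr (_ * _).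
    rewrite -(p_psi _ _ _ (lam_psi^~ x) k k_bd) [RHS]mmap_intr_comp.
    apply: mmap_ext => // i; rewrite tnth_mktuple mmapX mmap1U.
    by rewrite /lambda_mul_args (unsplitK (inl i)).
  rewrite -(p_psi _ _ _ (lam_psi^~ y) k k_bd) [RHS]mmap_intr_comp.
  apply: mmap_ext => // i; rewrite tnth_mktuple mmapX mmap1U.
  by rewrite /lambda_mul_args (unsplitK (inr i)).
- rewrite [LHS]mul_polyP; congr (polyseq _)`_n.
  by rewrite pair_big; apply: eq_bigl.
Qed.

(** Two transfers are chained: the first finds polynomials [q k] representing psi^k(lambda^n(x)),
    the second uses them as power sums to reach lambda^m. *)
Lemma adams_lambda_comp m n x :
  lam m (lam n x) = mmap intr (fun i => lam i.+1 x) (Defs.comp_poly m n).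
Proof.
have [p [p_roots p_psi]] := mesym_power_sums (m * n).
pose U := {mpoly int[m * n]}.
pose iota : {rmorphism U -> U} :=
  comp_mpoly [tuple mesym (m * n) int i.+1 | i < m * n].
pose phi : {rmorphism U -> R} := mmap intr (fun i => lam i.+1 x).
have inj_iota : injective iota by move=> P Q; exact: msym_fundamental_un.
(* [q k] expresses e_n of the k-th powers of the roots. *)
have q_ex k : exists P : U,
    iota P = (\prod_(i < m * n) (1 + ('X_i ^+ k) *: 'X))`_n.
  set F := (X in X`_n); have sym_F : F`_n \is symmetric.
    apply/issymP => s; rewrite msym_coef; congr (polyseq _)`_n.
    rewrite /F rmorph_prod /= [RHS](reindex_inj (@perm_inj _ s)) /=.
    apply: eq_bigr => i _; rewrite rmorphD rmorph1 /= map_polyZ map_polyX /=.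
    by rewrite rmorphXn /= msymXU.
  by have [P [PF _]] := sym_fundamental sym_F; exists P.
have [q q_roots] := choice q_ex.
have q_psi k : (0 < k <= m)%N -> phi (q k) = psi k (lam n x).
  move=> /andP[k_gt0 le_km].
  apply: (@newton_transfer _ _ _ iota phi (fun j => p (k * j)%N) n (q k)
    (fun j => (\prod_(i < m * n) (1 + ('X_i ^+ k) *: 'X))`_j)
    (psi k \o lam^~ x) inj_iota tfR); last exact: q_roots.
    apply: newton_ext (newton_roots _ _ _ n) => // j /andP[j_gt0 _].
    rewrite [RHS]p_roots ?muln_gt0 ?k_gt0 //.
    by apply: eq_bigr => i _; rewrite exprM.
  apply: newton_ext (newton_map (psi k) (lam_psi n x)) => // j /andP[j_gt0 le_jn].
  rewrite [RHS](p_psi _ _ _ (lam_psi^~ x)) /= ?psiM //.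
  (* The index kj is at most mn, the range in which [p] specializes to the psi^k. *)
  by rewrite muln_gt0 k_gt0 j_gt0 leq_mul.
apply/esym.
have -> : mmap intr (fun i => lam i.+1 x) (Defs.comp_poly m n) =
  phi (Defs.comp_poly m n) by [].
apply: (@newton_transfer _ _ _ iota phi q m (Defs.comp_poly m n)
  (fun k => (\prod_(J : {set 'I_(m * n)} | #|J| == n)
     (1 + (\prod_(i in J) 'X_i) *: 'X : {poly U}))`_k)
  (lam^~ (lam n x)) inj_iota tfR); last exact: comp_polyP.
- apply: newton_ext (newton_roots _ _ _ m) => // k _.
  (* e_n of the k-th powers of the roots is also the k-th power sum of the products of n distinct
     roots. *)
  rewrite [RHS]q_roots coef_prod1D rmorph_sum; apply: eq_bigr => J _.
  rewrite rmorph_prod -prodrXl; apply: eq_bigr => i _.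
  by rewrite /= mmapX mmap1U.
- apply: newton_ext (lam_psi m (lam n x)) => // k k_bd.
  by rewrite [RHS]q_psi.
Qed.

Theorem adams_lambda_structure : lambda_structure lam.
Proof.
have lam0 x : lam 0 x = 1 by case: (lam_psi 0 x).
split=> //.
- move=> x; have [_ /(_ 0%N isT)] := lam_psi 1 x.
  by rewrite big_ord1 lam0 mulr1 mul1r psi1.
- move=> [//|[//|n]] _.
  (* As psi^k(1) = 1, the element 1 behaves as a single root equal to 1. *)
  pose e k : R := (1 + 1 *: 'X : {poly R})`_k.
  rewrite (@newton_unique _ _ (lam^~ 1) e (psi^~ 1) tfR (lam_psi _ _)).
    by rewrite /e scale1r coefD coef1 coefX addr0.
  by apply: newton_ext (newton_one_root 1 _) => // k _; rewrite expr1n rmorph1.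
- move=> n x y; pose e k := \sum_(i < k.+1) lam i x * lam (k - i) y.
  apply: (@newton_unique _ n (lam^~ (x + y)) e (psi^~ (x + y)) tfR (lam_psi _ _)).
  apply: newton_ext (newton_mul (lam_psi^~ x) (lam_psi^~ y) n) => // k _.
  by rewrite rmorphD.
- exact: adams_lambda_mul.
- exact: adams_lambda_comp.
Qed.

End Wilkerson.

(** * Weights attached to sets of primes *)

(** An increasing sequence of primes, possibly skipping some: infinitely many distinct primes
    suffice. *)
Fixpoint nth_prime (i : nat) : nat :=
  if i is j.+1 then sval (prime_above (nth_prime j)) else 2.

Lemma nth_prime_prime i : prime (nth_prime i).
Proof. by case: i => [//|i] /=; case: prime_above. Qed.

Lemma nth_prime_inj : injective nth_prime.
Proof.
apply: incn_inj; apply: leq_mono; apply: (homo_ltn ltn_trans) => i /=.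
by case: prime_above.
Qed.

Definition prime_subset (b : nat -> bool) : nat_pred :=
  [pred p | `[< exists2 i, nth_prime i = p & b i >]].

Lemma prime_subset_nth b i : (nth_prime i \in prime_subset b) = b i.
Proof.
rewrite inE; apply/asboolP/idP => [[j /nth_prime_inj <- //]|bi].
by exists i.
Qed.

(* The factor [k] makes the Frobenius congruences [psi_p = x^p mod p] hold over
   a binomial domain; the second factor is completely multiplicative in [k]
   and equal to 0 or 1 at will at each prime. *)
Definition weight (b : nat -> bool) (k : nat) : nat :=
  (k * (prime_subset b).-nat k)%N.

Lemma weight1 b : weight b 1 = 1%N.
Proof. by []. Qed.

Lemma weightM b m n : weight b (m * n) = (weight b m * weight b n)%N.
Proof. by rewrite /weight pnatM mulnACA mulnb. Qed.

(** At a prime p of the sequence the weight is p or 0 according to whether p is selected. *)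
Lemma weight_inj b b' : weight b =1 weight b' -> b = b'.
Proof.
move=> bb'; apply/funext => i; have /eqP := bb' (nth_prime i).
rewrite /weight eqn_pmul2l ?prime_gt0 ?nth_prime_prime //.
rewrite !pnatE ?nth_prime_prime // !prime_subset_nth.
by case: (b i) (b' i) => [] [].
Qed.

Lemma no_injection_cantor (f : (nat -> bool) -> nat) : ~ injective f.
Proof.
(* By injectivity [d] takes at [f b] the negation of [b (f b)], which is contradictory for [b] equal
   to [d]. *)
move=> inj_f; pose d n := ~~ `[< exists2 b, f b = n & b n >].
have := erefl (d (f d)); rewrite {1}/d; case: asboolP => [[b /inj_f -> -> //]|ne].
by case dfd: (d (f d)) => // _; apply: ne; exists d.
Qed.

Lemma torsionfree_mulrn_inj (R : comNzRingType) (u : R) :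
  Ztorsionfree R -> u != 0 -> injective (GRing.natmul u).
Proof.
move=> tfR u_neq0 m n; wlog le_mn: m n / (m <= n)%N => [H E|E].
  by have [/H->|/ltnW/H->] := leqP m n.
apply/eqP; rewrite eqn_leq le_mn leqNgt -subn_gt0; apply: contra u_neq0 => d_gt0.
by apply/eqP/(tfR _ _ d_gt0); rewrite mulrnBr // E subrr.
Qed.

(** * Rescaling operations on rings with an adic filtration *)

Section Adic.
Variables (R : comNzRingType) (a : R).

Lemma adic_sum n m (F : 'I_m -> R) :
  (forall i, adic a n (F i)) -> adic a n (\sum_i F i).
Proof.
by have [a0 aD _] := adic_is_ideal a n => aF; elim/big_ind: _.
Qed.

Lemma adic_mulr n x y : adic a n y -> adic a n (x * y).
Proof. by case: (adic_is_ideal a n) => _ _; apply. Qed.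

End Adic.

(* [A[X]], [A[X]/X^N] and [A[[X]]] treated alike: [cs_coef n] is the coefficient
   of [X^n], meaningful for [n] in [cs_dom] only ([n < N] in the truncated
   case), and [cs_scale a] is the substitution of [a X] for [X]. *)
Record coef_system (R A : comNzRingType) (X : R) := CoefSystem {
  cs_coef :> nat -> R -> A;
  cs_dom : pred nat;
  cs_scale : nat -> R -> R;
  cs_dom1 : cs_dom 1;
  cs_dom_le : forall m n, (m <= n)%N -> cs_dom n -> cs_dom m;
  cs_inj : forall x y, (forall n, cs_dom n -> cs_coef n x = cs_coef n y) -> x = y;
  cs_coefB : forall n, zmod_morphism (cs_coef n);
  cs_coef1 : forall n, cs_coef n 1 = (n == 0%N)%:R;
  cs_coefM : forall n x y, cs_dom n ->
    cs_coef n (x * y) = \sum_(i < n.+1) cs_coef i x * cs_coef (n - i)%N y;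
  cs_coefX : forall n, cs_dom n -> cs_coef n X = (n == 1%N)%:R;
  cs_coef_scale : forall a n x, cs_dom n ->
    cs_coef n (cs_scale a x) = cs_coef n x *+ a ^ n;
  cs_div : forall x, cs_coef 0 x = 0 -> exists y, x = y * X
}.

Section CoefSystem.
Variables (R A : comNzRingType) (X : R) (c : coef_system A X).
Hypothesis tfA : Ztorsionfree A.

HB.instance Definition _ n :=
  GRing.isZmodMorphism.Build R A (c n) (cs_coefB c n).

Lemma cs_coefDMn n x y k : c n (x + y *+ k) = c n x + c n y *+ k.
Proof. by rewrite raddfD raddfMn. Qed.

Lemma cs_scale_zmod_morphism a : zmod_morphism (cs_scale c a).
Proof.
move=> x y; apply: (@cs_inj _ _ _ c) => n dn.
by rewrite raddfB /= !cs_coef_scale // raddfB mulrnBl.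
Qed.

Lemma cs_scale_monoid_morphism a : monoid_morphism (cs_scale c a).
Proof.
split=> [|x y]; apply: (@cs_inj _ _ _ c) => n dn; rewrite cs_coef_scale //.
  by rewrite cs_coef1; case: n dn => [|n] _; rewrite ?expn0 // mul0rn.
rewrite !cs_coefM // -sumrMnl; apply: eq_bigr => i _.
have le_in : (i <= n)%N by rewrite -ltnS.
have [di dni] : cs_dom c i /\ cs_dom c (n - i)%N.
  by split; apply: cs_dom_le dn; rewrite ?leq_subr.
rewrite !cs_coef_scale //.
by rewrite mulrnAl mulrnAr -mulrnA -expnD subnK.
Qed.

HB.instance Definition _ a :=
  GRing.isZmodMorphism.Build R R (cs_scale c a) (cs_scale_zmod_morphism a).
HB.instance Definition _ a :=
  GRing.isMonoidMorphism.Build R R (cs_scale c a) (cs_scale_monoid_morphism a).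

Lemma cs_torsionfree : Ztorsionfree R.
Proof.
move=> n x n_gt0 xn0; apply: (@cs_inj _ _ _ c) => m _; rewrite raddf0.
by apply: (tfA n_gt0); rewrite -raddfMn xn0 raddf0.
Qed.

Lemma cs_scaleX a : cs_scale c a X = X *+ a.
Proof.
apply: (@cs_inj _ _ _ c) => n dn; rewrite cs_coef_scale // raddfMn /= cs_coefX //.
by case: (eqVneq n 1%N) => [->|_]; rewrite ?expn1 // !mul0rn.
Qed.

Lemma cs_scale_adic a n x : adic X n x -> adic X n (cs_scale c a x).
Proof.
move=> [r ->]; exists (cs_scale c a r *+ a ^ n).
by rewrite rmorphM rmorphXn /= cs_scaleX exprMn_n mulrnAr mulrnAl.
Qed.

Definition adams b k : {rmorphism R -> R} := cs_scale c (weight b k).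

Lemma adams1 b x : adams b 1 x = x.
Proof.
apply: (@cs_inj _ _ _ c) => n dn.
by rewrite /= weight1 cs_coef_scale // exp1n.
Qed.

Lemma adamsM b m n x : adams b (m * n) x = adams b m (adams b n x).
Proof.
apply: (@cs_inj _ _ _ c) => k dk.
by rewrite /= weightM !cs_coef_scale // mulnC expnMn mulrnA.
Qed.

(** The input that varies with the ring: division over a Q-algebra, binomial coefficients for dual
    numbers. Its second clause gives closure of the filtration ideals. *)
Hypothesis newton_solvable : forall b x, exists e : nat -> R,
  (forall n, newton n e (fun k => adams b k x)) /\
  (forall n, adic X n x -> forall i, (0 < i)%N -> adic X n (e i)).

Lemma cs_coefMX r : (c 0%N (r * X) = 0) * (c 1%N (r * X) = c 0%N r).
Proof.
have d1 := cs_dom1 c; have d0 : cs_dom c 0 by exact: cs_dom_le d1.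
rewrite !cs_coefM // big_ord1 big_ord_recl big_ord1 /= !cs_coefX //=.
by rewrite !mulr0 mulr1 addr0.
Qed.

(** Otherwise f(X) would be a multiple of X^2, and then so would g(f(X)) = X. *)
Lemma adic_iso_coef1 (f g : {rmorphism R -> R}) :
  (forall n x, adic X n x -> adic X n (f x)) ->
  (forall n x, adic X n x -> adic X n (g x)) -> cancel f g ->
  c 1%N (f X) != 0.
Proof.
move=> f_adic g_adic fK; apply/eqP => cfX0.
have [r fX] : adic X 1 (f X) by apply: f_adic; exists 1; rewrite mul1r.
move: cfX0; rewrite fX expr1 cs_coefMX => /cs_div[s rE].
have [t] : adic X 2 (g (f X)).
  by apply: g_adic; exists s; rewrite fX rE expr1 expr2 mulrA.
rewrite fK expr2 mulrA => /(congr1 (c 1%N)); rewrite cs_coefMX cs_coefMX.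
by rewrite cs_coefX ?cs_dom1 // => /eqP; rewrite oner_eq0.
Qed.

Theorem coef_system_uncountably_many : uncountably_many_filtered_lambda (adic X).
Proof.
have lam_ex b : exists lam : nat -> R -> R, forall x,
    (forall n, newton n (lam^~ x) (fun k => adams b k x)) /\
    (forall n, adic X n x -> forall i, (0 < i)%N -> adic X n (lam i x)).
  have [lam lamP] := choice (newton_solvable b).
  by exists (fun n x => lam x n).
have [lam lamP] := choice lam_ex.
have lam_newton b : lambda_of_adams (adams b) (lam b).
  by move=> n x; case: (lamP b x).
have iso_weight b b' : filtered_lambda_iso (adic X) (lam b) (lam b') -> b = b'.
  move=> [f [g [[f_adic f_lam] [g_adic _] fK _]]].
  have cfX := adic_iso_coef1 f_adic g_adic fK.
  (* Newton's identities constrain psi^k for k > 0 only; at k = 0 both weights vanish. *)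
  apply: weight_inj => k; have [->|k_gt0] := posnP k; first by rewrite /weight !mul0n.
  (* f carries the operations on X to those on f(X), and these determine the power sums. *)
  have fX : f (adams b k X) = adams b' k (f X).
    apply: (@power_sums_unique _ k (lam b' ^~ (f X)) (f \o adams b ^~ X)
      (adams b' ^~ (f X)) _ (lam_newton b' k (f X)) k); last by rewrite k_gt0 leqnn.
    apply: newton_ext (newton_map f (lam_newton b k X)) => // j _.
    exact: f_lam.
  (* Both sides have as coefficient of X the nonzero coefficient of X in f(X), multiplied by the
     respective weight. *)
  move/(congr1 (c 1%N)): fX.
  rewrite /= cs_scaleX cs_coef_scale ?cs_dom1 // !raddfMn expn1 /=.
  exact: (torsionfree_mulrn_inj tfA cfX).
exists (range lam); split.
- move=> _ [b _ <-]; split; last first.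
    by move=> i n x i_gt0 xn; case: (lamP b x) => _; apply.
  apply: (adams_lambda_structure cs_torsionfree (adams1 b) _ (lam_newton b)).
  by move=> m n x _ _; exact: adamsM.
- by move=> _ _ [b _ <-] [b' _ <-] /iso_weight ->.
(* Equal structures are isomorphic through the identity, so [lam] is injective and a countable range
   would inject the boolean sequences into the integers. *)
- move=> /countable_injP[h inj_h]; apply: (@no_injection_cantor (h \o lam)).
  move=> b b' /= /inj_h lam_bb'; apply: iso_weight.
  rewrite lam_bb' ?inE; [|by exists b|by exists b'].
  by exists idfun, idfun.
Qed.

End CoefSystem.

(** * Solving Newton's identities *)

Lemma newton_solvable_of_divisible (R A : comNzRingType) (X : R)
    (c : coef_system A X) :
  (forall n, (0 < n)%N -> exists u : R, u *+ n = 1) ->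
  forall b x, exists e : nat -> R,
    (forall n, newton n e (fun k => adams c b k x)) /\
    (forall n, adic X n x -> forall i, (0 < i)%N -> adic X n (e i)).
Proof.
move=> divR b x.
have inv_ex n : exists u : R, u *+ n.+1 = 1 by exact: divR.
have [inv invP] := choice inv_ex.
pose F n (u : nat -> R) := if n is m.+1 then
  inv m * \sum_(k < m.+1) (-1) ^+ k * (adams c b k.+1 x * u (m - k)%N) else 1.
have [[//|n] u v uv|e eE] := @strong_rec_exists R F 0.
  by congr (_ * _); apply: eq_bigr => k _; rewrite uv // ltnS leq_subr.
exists e; split=> [n|n xn [//|i] _].
  by split=> [|m _]; rewrite eE //= -mulrnAl invP mul1r.
(* Every summand has a factor psi^(k+1)(x), which lies in each filtration ideal containing x. *)
rewrite eE; apply: adic_mulr; apply: adic_sum => k.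
by apply: adic_mulr; rewrite mulrC; apply: adic_mulr; exact: cs_scale_adic.
Qed.

(** The solution consists of the binomial coefficients of b, that is, of the series (1 + t)^b with
    logarithmic derivative b/(1 + t). *)
Lemma binomial_newton (B : comNzRingType) (b : B) : binomial_domain B ->
  exists e : nat -> B, forall n, newton n e (fun=> b).
Proof.
move=> [tfB binB].
have bin_ex n : exists c : B, c *+ n`! = \prod_(i < n) (b - i%:R).
  by case: n => [|n]; [exists 1; rewrite big_ord0 | exact: binB].
have [bin binP] := choice bin_ex.
have binS n : bin n.+1 *+ n.+1 = (b - n%:R) * bin n.
  apply/eqP; rewrite -subr_eq0; apply/eqP/(tfB n`!); first exact: fact_gt0.
  rewrite mulrnBl -mulrnA -factS binP big_ord_recr /= -binP.
  by rewrite mulrC mulrnAr subrr.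
exists bin => n; split=> [|m _]; first by have := binP 0%N; rewrite big_ord0.
elim: m => [|m IHm].
  by rewrite big_ord1 binS subr0 mul1r.
(* The remaining term, -(m + 1) times the binomial coefficient of index m + 1, is minus the previous
   identity, whose sum is the present one shifted by one. *)
rewrite binS big_ord_recl mul1r subn0 mulrBl; congr (_ + _).
rewrite mulr_natl IHm -sumrN; apply: eq_bigr => k _.
by rewrite /= exprS mulN1r mulNr.
Qed.

(** The series 1 + y u(t), with u the sum of (-1)^(k-1) s_k t^k over k > 0, has logarithmic
    derivative y u'(t), because all further products carry y^2 = 0. *)
Lemma square_zero_newton (R : comNzRingType) (y : R) (s : nat -> nat) n :
  y * y = 0 ->
  newton n (fun k => if k is j.+1 then (-1) ^+ j * (y *+ s k) else 1)
           (fun k => y *+ (k * s k)).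
Proof.
move=> yy0; split=> // m _.
rewrite big_ord_recr /= subnn mulr1 big1 => [|k _].
  by rewrite add0r -mulrnAr -mulrnA mulnC.
case E: (m - k)%N => [|j]; first by move: (ltn_ord k); rewrite -subn_gt0 E.
by rewrite (mulrCA (y *+ _)) mulrnAl [y * _]mulrnAr yy0 !mul0rn !mulr0.
Qed.

(** * Coefficients of polynomials, truncated polynomials and power series *)

Definition poly_coef_system (A : comNzRingType) : coef_system A ('X : {poly A}).
Proof.
pose scale a (p : {poly A}) := \poly_(i < size p) (p`_i *+ a ^ i).
apply: (@CoefSystem {poly A} A 'X (fun n p => p`_n) predT scale).
- by [].
- by [].
- by move=> p q pq; apply/polyP => i; exact: pq.
- by move=> n p q; rewrite coefB.
- by move=> n; rewrite coef1.
- by move=> n p q _; rewrite coefM.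
- by move=> n _; rewrite coefX.
- move=> a n p _; rewrite coef_poly; case: ltnP => // le_pn.
  by rewrite nth_default // mul0rn.
- move=> p p0; exists (drop_poly 1 p); apply/polyP => -[|i].
    by rewrite p0 coefMX.
  by rewrite coefMX coef_drop_poly addn1.
Defined.

Lemma truncated_coef (A : comNzRingType) N (p : {poly A}) n : (n < N)%N ->
  (in_qpoly 'X^N p : {poly A})`_n = p`_n.
Proof.
move=> lt_nN; have N_gt0 : (0 < N)%N by exact: leq_trans lt_nN.
rewrite /= mk_monic_Xn prednK // -Pdiv.RingMonic.take_poly_rmodp.
by rewrite coef_take_poly lt_nN.
Qed.

Lemma truncated_coef_inj (A : comNzRingType) N (p q : truncated_poly A N) :
  (0 < N)%N ->
  (forall n, (n < N)%N -> (p : {poly A})`_n = (q : {poly A})`_n) -> p = q.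
Proof.
move=> N_gt0 pq; apply/val_inj/polyP => n; have [/pq //|le_Nn] := ltnP n N.
have small (r : truncated_poly A N) : (r : {poly A})`_n = 0.
  rewrite nth_default // (leq_trans _ le_Nn) // -ltnS.
  by apply: leq_trans (size_mk_monic r) _; rewrite mk_monic_Xn prednK ?size_polyXn.
by rewrite [LHS]small [RHS]small.
Qed.

Definition truncated_coef_system (A : comNzRingType) N :
  (2 <= N)%N -> coef_system A (truncated_x A N).
Proof.
move=> N_ge2; pose R := truncated_poly A N.
pose scale a (p : R) : R :=
  in_qpoly 'X^N (\poly_(i < size (p : {poly A})) ((p : {poly A})`_i *+ a ^ i)).
apply: (@CoefSystem R A _ (fun n p => (p : {poly A})`_n) (fun n => n < N)%N scale).
- exact: N_ge2.
- by move=> m n le_mn /(leq_ltn_trans le_mn).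
- by move=> p q; apply: truncated_coef_inj; exact: ltnW.
- by move=> n p q; rewrite /= coefB.
- by move=> n; rewrite /= coef1.
- by move=> n p q lt_nN; rewrite truncated_coef // coefM.
- by move=> n lt_nN; rewrite truncated_coef // coefX.
- move=> a n p lt_nN; rewrite truncated_coef // coef_poly; case: ltnP => // le_pn.
  by rewrite nth_default // mul0rn.
- move=> p p0; exists (in_qpoly 'X^N (drop_poly 1 (p : {poly A}))).
  rewrite -in_qpolyM; apply: truncated_coef_inj => [|[|i] lt_iN].
  + exact: ltnW.
  + by rewrite truncated_coef // p0 coefMX.
  + by rewrite truncated_coef // coefMX coef_drop_poly addn1.
Defined.

Definition powser_coef_system (A : comNzRingType) : coef_system A (powserX A).
Proof.
pose scale a (f : powser A) := PowSer (fun n => pcoef f n *+ a ^ n).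
apply: (@CoefSystem (powser A) A _ (fun n f => pcoef f n) predT scale) => //.
- by move=> f g fg; apply: powserP => n; exact: fg.
- move=> f f0; exists (PowSer (fun n => pcoef f n.+1)); apply: powserP => -[|n] /=.
    by rewrite big_ord1 mulr0.
  rewrite big_ord_recr big_ord_recr /= subnn mulr0 addr0 subSn // subnn mulr1.
  rewrite big1 ?add0r // => i _.
  by rewrite subSn 1?ltnW // eqSS subn_eq0 leqNgt ltn_ord mulr0.
Defined.

Definition dual_coef_system (B : comNzRingType) : coef_system B (eps B) :=
  truncated_coef_system B (leqnn 2).

(** * Dual numbers over a binomial domain *)

Lemma dual_newton_solvable (B : comNzRingType) : binomial_domain B ->
  forall b (x : dual_numbers B), exists e : nat -> dual_numbers B,
    (forall n, newton n e (fun k => adams (dual_coef_system B) b k x)) /\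
    (forall n, adic (eps B) n x -> forall i, (0 < i)%N -> adic (eps B) n (e i)).
Proof.
move=> hB b x; pose c := dual_coef_system B.
pose const : {rmorphism B -> dual_numbers B} := qpolyC 'X^2.
pose y := const (c 1%N x) * eps B.
have [bin binP] := binomial_newton (c 0%N x) hB.
have yy0 : y * y = 0.
  by rewrite /y mulrACA -!expr2 truncated_x_pow ?mulr0.
(* The weight of k is k times [s k], so the quotient a_k / k is an integer. *)
pose s k : nat := (prime_subset b).-nat k.
have dualP (u v : dual_numbers B) : c 0%N u = c 0%N v -> c 1%N u = c 1%N v -> u = v.
  by move=> uv0 uv1; apply: truncated_coef_inj => // -[|[|n]].
have y0 : c 0%N y = 0 by rewrite cs_coefMX.
have y1 : c 1%N y = c 1%N x by rewrite cs_coefMX /= coefC.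
have adamsE k : const (c 0%N x) + y *+ weight b k = adams c b k x.
  apply: dualP; rewrite cs_coefDMn cs_coef_scale // ?y0 ?y1.
    by rewrite mul0rn addr0 expn0 [LHS]coefC.
  by rewrite expn1 [X in X + _]coefC add0r.
have xE : x = const (c 0%N x) + y.
  by rewrite -[LHS](adams1 c b) -adamsE weight1.
pose f k := if k is j.+1 then (-1) ^+ j * (y *+ s k) else 1.
have fP n : newton n f (fun k => y *+ weight b k) by exact: square_zero_newton.
pose e n := \sum_(i < n.+1) const (bin i) * f (n - i)%N.
have eP n : newton n e (fun k => adams c b k x).
  by apply: newton_ext (newton_mul (fun n => newton_map const (binP n)) fP n).
exists e; split=> // -[|n] xn i i_gt0; first by rewrite [adic _ _]adic_top.
have x0 : c 0%N x = 0.
  by case: xn => r ->; rewrite [eps B ^+ _]exprSr mulrA cs_coefMX.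
have xy : x = y by rewrite [LHS]xE x0 rmorph0 add0r.
(* Without constant term only the factor [f] remains, by uniqueness of solutions; each [f i] with i
   > 0 is a multiple of x, hence lies in every ideal containing x. *)
have -> : e i = f i.
  apply: (newton_unique (cs_torsionfree c hB.1) (eP i)).
  apply: newton_ext (fP i) => // k _.
  by rewrite -adamsE x0 rmorph0 add0r.
by case: i i_gt0 => // i _; rewrite /f mulrnAr -mulrnAl -xy; exact: adic_mulr.
Qed.

(** * Uncountably many structures on the four rings *)

Theorem theorem3 (B : comNzRingType) (hB : binomial_domain B)
    (A : comAlgType rat) (hA : Ztorsionfree A) (N : nat) (hN : (2 <= N)%N) :
  [/\ uncountably_many_filtered_lambda (adic (eps B)),
      uncountably_many_filtered_lambda (adic ('X : {poly A})),
      uncountably_many_filtered_lambda (adic (truncated_x A N))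
    & uncountably_many_filtered_lambda (adic (powserX A))].
Proof.
have divA n : (0 < n)%N -> (n%:R^-1)%:A *+ n = 1 :> A.
  move=> n_gt0; rewrite scalerMnl -mulr_natr mulVf ?scale1r //.
  by rewrite Num.Theory.pnatr_eq0 -lt0n.
split.
- apply: (coef_system_uncountably_many (c := dual_coef_system B) hB.1).
  exact: dual_newton_solvable.
- apply: (coef_system_uncountably_many (c := poly_coef_system A) hA).
  apply: newton_solvable_of_divisible => n n_gt0.
  by exists ((n%:R^-1)%:A)%:P; rewrite -polyCMn divA.
- apply: (coef_system_uncountably_many (c := truncated_coef_system A hN) hA).
  apply: newton_solvable_of_divisible => n n_gt0.
  by exists (qpolyC 'X^N (n%:R^-1)%:A); rewrite -raddfMn divA //= rmorph1.
- apply: (coef_system_uncountably_many (c := powser_coef_system A) hA).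
  apply: newton_solvable_of_divisible => n n_gt0.
  exists (PowSer (fun k => (n%:R^-1)%:A *+ (k == 0%N))).
  have powserMn (f : powser A) k : pcoef (f *+ n) k = pcoef f k *+ n.
    by elim: (n) => // m IHm; rewrite !mulrS -IHm.
  by apply: powserP => k; rewrite powserMn /= mulrnAC divA.
Qed.
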